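(* Let $T\subseteq R$ be an extension of rings and let $X=\{x_1,\dots,x_n\}$ be a finite set of indeterminates. Then the following are equivalent: (1) $T+XR[[X]]$ is left endo-Noetherian; (2) $R[[X]]$ is left endo-Noetherian.
   Context: All rings are associative with identity, not necessarily commutative; $T\subseteq R$ an extension of rings means that $T$ is a subring of $R$. $R[[X]]=R[[x_1,\dots,x_n]]$ is the formal power series ring over $R$ (the indeterminates commute with each other and with the elements of $R$), and $T+XR[[X]]$ is its subring of power series whose constant term lies in $T$. For a ring $A$ and $a\in A$, $\ell.\mathrm{ann}_A(a)=\{b\in A: ba=0\}$. A ring $A$ is called left endo-Noetherian if for every sequence $(a_i)_{i\in\mathbb N}$ of elements of $A$ with $\ell.\mathrm{ann}_A(a_1)\subseteq \ell.\mathrm{ann}_A(a_2)\subseteq\cdots$, there is a positive integer $m$ with $\ell.\mathrm{ann}_A(a_k)=\ell.\mathrm{ann}_A(a_m)$ for all $k\ge m$. *)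

(* Defs.v *)
(* Mathematical Components; boolp provides extensionality and choice for the
   type of coefficient families. *)
From HB Require Import structures.
From mathcomp Require Import all_boot all_algebra.
From mathcomp Require Import mpoly.
From mathcomp Require boolp.

Set Implicit Arguments.
Unset Strict Implicit.
Unset Printing Implicit Defensive.

Import GRing.Theory.

Local Open Scope ring_scope.

(* [pzRingType] is the class of associative unital rings, not necessarily
   commutative, the zero ring being allowed. *)

Definition lann (A : pzRingType) (a : A) : {pred A} := [pred b | b * a == 0].

Definition left_endo_noetherian (A : pzRingType) : Prop :=
  forall a : nat -> A,
    (forall i, {subset lann (a i) <= lann (a i.+1)}) ->
    exists m, forall k, (m <= k)%N -> lann (a k) =i lann (a m).

(* A series in n commuting indeterminates is its family of coefficients, one
   for each monomial. *)
Record mseries (n : nat) (R : pzRingType) :=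
  MSeries { mscoef :> 'X_{1..n} -> R }.

HB.instance Definition _ n R := boolp.gen_eqMixin (mseries n R).
HB.instance Definition _ n R := boolp.gen_choiceMixin (mseries n R).

Section SeriesRing.
Variables (n : nat) (R : pzRingType).
Implicit Types (f g h : mseries n R) (m : 'X_{1..n}).

Lemma mseriesP f g : (forall m, f m = g m) -> f = g.
Proof.
by case: f g => [f] [g] /= fg; congr MSeries; apply/boolp.funext.
Qed.

Definition ms0 : mseries n R := MSeries (fun=> 0).
Definition ms1 : mseries n R := MSeries (fun m => (m == 0%MM)%:R).
Definition msopp f : mseries n R := MSeries (fun m => - f m).
Definition msadd f g : mseries n R := MSeries (fun m => f m + g m).

(* The Cauchy product: the bound on degrees only makes the index type finite,
   as k.1 + k.2 = m forces mdeg k.1, mdeg k.2 <= mdeg m. *)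
Definition msmul f g : mseries n R := MSeries (fun m =>
  \sum_(k : 'X_{1..n < (mdeg m).+1, (mdeg m).+1} | m == (k.1 + k.2)%MM)
    f k.1 * g k.2).

Fact msaddA : associative msadd.
Proof. by move=> f g h; apply: mseriesP => m /=; rewrite addrA. Qed.
Fact msaddC : commutative msadd.
Proof. by move=> f g; apply: mseriesP => m /=; rewrite addrC. Qed.
Fact msadd0 : left_id ms0 msadd.
Proof. by move=> f; apply: mseriesP => m /=; rewrite add0r. Qed.
Fact msaddN : left_inverse ms0 msopp msadd.
Proof. by move=> f; apply: mseriesP => m /=; rewrite addNr. Qed.

HB.instance Definition _ :=
  GRing.isZmodule.Build (mseries n R) msaddA msaddC msadd0 msaddN.

Lemma sum_bmultinom_eq N (a : 'X_{1..n}) (F : 'X_{1..n} -> R) :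
  (mdeg a < N)%N -> \sum_(k : 'X_{1..n < N} | a == k) F k = F a.
Proof.
by move=> aN; rewrite (big_pred1 (BMultinom aN)) // => k; rewrite eq_sym.
Qed.

Lemma msmul_widen N f g m : (mdeg m < N)%N ->
  msmul f g m =
  \sum_(a : 'X_{1..n < N}) \sum_(b : 'X_{1..n < N} | m == (a + b)%MM)
    f a * g b.
Proof.
move=> mN /=.
pose W (k : 'X_{1..n < (mdeg m).+1}) : 'X_{1..n < N} :=
  BMultinom (leq_trans (bmdeg k) mN).
pose V (k : 'X_{1..n < N}) : 'X_{1..n < (mdeg m).+1} :=
  insubd bm0 (k : 'X_{1..n}).
rewrite pair_big_dep /=.
rewrite (reindex_onto (fun k => (W k.1, W k.2)) (fun k => (V k.1, V k.2))) /=.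
  apply: eq_bigl => -[a b] /=.
  have WK c : V (W c) = c by apply: val_inj; rewrite val_insubd /= bmdeg.
  by rewrite !WK eqxx andbT.
move=> [a b] /= /eqP mE.
by congr pair; apply: val_inj; rewrite /= val_insubd mE mdegD ltnS
   ?leq_addr ?leq_addl.
Qed.

Fact msmulA : associative msmul.
Proof.
move=> f g h; apply: mseriesP => m; set N := (mdeg m).+1.
pose S3 := \sum_(a : 'X_{1..n < N}) \sum_(b : 'X_{1..n < N})
  \sum_(c : 'X_{1..n < N} | m == (a + b + c)%MM) f a * g b * h c.
transitivity S3.
  rewrite (@msmul_widen N) //; apply: eq_bigr => a _.
  transitivity (\sum_(p : 'X_{1..n < N} | m == (a + p)%MM)
    \sum_(b : 'X_{1..n < N}) \sum_(c : 'X_{1..n < N} | (b + c)%MM == p)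
      f a * (g b * h c)).
    apply: eq_bigr => p _.
    rewrite (@msmul_widen N) ?bmdeg // mulr_sumr; apply: eq_bigr => b _.
    by rewrite mulr_sumr; apply: eq_bigl => c; rewrite eq_sym.
  rewrite exchange_big; apply: eq_bigr => b _ /=.
  rewrite (exchange_big_dep xpredT) //= [RHS]big_mkcond.
  apply: eq_bigr => c _; rewrite -addmA.
  case: eqP => [mE|mN].
    rewrite mulrA.
    rewrite -[RHS](@sum_bmultinom_eq N (b + c)%MM (fun=> f a * g b * h c)).
      by apply: eq_bigl => p; rewrite andb_idl // => /eqP <-; rewrite mE.
    by have /(congr1 mdeg) mdE := mE; rewrite ltnS mdE [leqRHS]mdegD leq_addl.
  by rewrite big_pred0 // => p; apply/andP => -[/eqP mE /eqP pE]; rewrite pE in mN.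
transitivity (\sum_(c : 'X_{1..n < N}) \sum_(a : 'X_{1..n < N})
  \sum_(b : 'X_{1..n < N} | m == (a + b + c)%MM) f a * g b * h c).
  rewrite [RHS]exchange_big; apply: eq_bigr => a _ /=.
  by rewrite [RHS](exchange_big_dep xpredT).
rewrite (@msmul_widen N) // [RHS](exchange_big_dep xpredT) //; apply: eq_bigr => c _.
symmetry; transitivity (\sum_(p : 'X_{1..n < N} | m == (p + c)%MM)
  \sum_(a : 'X_{1..n < N}) \sum_(b : 'X_{1..n < N} | (a + b)%MM == p)
    f a * g b * h c).
  apply: eq_bigr => p _.
  rewrite (@msmul_widen N) ?bmdeg // mulr_suml; apply: eq_bigr => a _.
  by rewrite mulr_suml; apply: eq_bigl => b; rewrite eq_sym.
rewrite exchange_big; apply: eq_bigr => a _ /=.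
rewrite (exchange_big_dep xpredT) //= [RHS]big_mkcond.
apply: eq_bigr => b _.
case: eqP => [mE|mN].
  rewrite -[RHS](@sum_bmultinom_eq N (a + b)%MM (fun=> f a * g b * h c)).
    by apply: eq_bigl => p; rewrite andb_idl // => /eqP <-; rewrite mE.
  by have /(congr1 mdeg) mdE := mE; rewrite ltnS mdE [leqRHS]mdegD leq_addr.
by rewrite big_pred0 // => p; apply/andP => -[/eqP mE /eqP pE]; rewrite pE in mN.
Qed.

Fact msmul1 : left_id ms1 msmul.
Proof.
move=> f; apply: mseriesP => m; rewrite (@msmul_widen (mdeg m).+1) //.
rewrite (bigD1 bm0) //= [X in _ + X]big1 => [|a a0].
  rewrite addr0 -[RHS](@sum_bmultinom_eq (mdeg m).+1) //.
  by apply: eq_big => [b|b _]; rewrite ?add0m // eqxx mul1r.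
by apply: big1 => b _; rewrite (_ : (_ == _) = false) ?mul0r //; apply/negbTE.
Qed.

Fact ms1mul : right_id ms1 msmul.
Proof.
move=> f; apply: mseriesP => m; rewrite (@msmul_widen (mdeg m).+1) //.
rewrite (exchange_big_dep xpredT) //=.
rewrite (bigD1 bm0) //= [X in _ + X]big1 => [|a a0].
  rewrite addr0 -[RHS](@sum_bmultinom_eq (mdeg m).+1) //.
  by apply: eq_big => [b|b _]; rewrite ?addm0 // eqxx mulr1.
by apply: big1 => b _; rewrite (_ : (_ == _) = false) ?mulr0 //; apply/negbTE.
Qed.

Fact msmulDl : left_distributive msmul +%R.
Proof.
move=> f g h; apply: mseriesP => m /=; rewrite -big_split.
by apply: eq_bigr => k _; rewrite mulrDl.
Qed.

Fact msmulDr : right_distributive msmul +%R.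
Proof.
move=> f g h; apply: mseriesP => m /=; rewrite -big_split.
by apply: eq_bigr => k _; rewrite mulrDr.
Qed.

HB.instance Definition _ := GRing.Zmodule_isPzRing.Build (mseries n R)
  msmulA msmul1 ms1mul msmulDl msmulDr.

Lemma mscoefB f g m : (f - g) m = f m - g m.
Proof. by []. Qed.

Lemma mscoef1 m : (1 : mseries n R) m = (m == 0%MM)%:R.
Proof. by []. Qed.

Lemma mscoefM f g m : (f * g) m =
  \sum_(k : 'X_{1..n < (mdeg m).+1, (mdeg m).+1} | m == (k.1 + k.2)%MM)
    f k.1 * g k.2.
Proof. by []. Qed.

Lemma mscoef0M f g : (f * g) 0%MM = f 0%MM * g 0%MM.
Proof.
rewrite [LHS](@msmul_widen 1) ?mdeg0 //.
have bm0E (a : 'X_{1..n < 1}) : (a : 'X_{1..n}) = 0%MM.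
  by apply/eqP; rewrite -mdeg_eq0 -leqn0 -ltnS bmdeg.
have b0E (a : 'X_{1..n < 1}) : a == bm0 by apply/eqP/val_inj; rewrite /= bm0E.
rewrite (big_pred1 bm0) => [|a]; last by rewrite /= b0E.
by rewrite (big_pred1 bm0) => [|a] //=; rewrite b0E bm0E add0m eqxx.
Qed.

(* Membership in T + X R[[X]]; X R[[X]] consists of the series without constant
   term. *)
Definition const_in (T : {pred R}) : {pred mseries n R} :=
  [pred f : mseries n R | f 0%MM \in T].

End SeriesRing.

Section ConstantTermSubring.
Variables (n : nat) (R : pzRingType) (T : subringClosed R).

Fact const_in_subring : subring_closed (@const_in n R T).
Proof.
split=> [|f g|f g]; rewrite !inE ?mscoef1 ?eqxx ?rpred1 //.
  by rewrite mscoefB; apply: rpredB.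
by rewrite mscoef0M; apply: rpredM.
Qed.

HB.instance Definition _ := GRing.isSubringClosed.Build (mseries n R)
  (@const_in n R T) const_in_subring.

(* The ring T + X R[[X]]. *)
Record cmseries := CMSeries {
  cmsval :> mseries n R;
  _ : cmsval \in @const_in n R T }.

HB.instance Definition _ := [isSub for cmsval].
HB.instance Definition _ := [Choice of cmseries by <:].
HB.instance Definition _ := GRing.SubChoice_isSubPzRing.Build (mseries n R)
  (@const_in n R T) cmseries const_in_subring.

End ConstantTermSubring.

(* Main.v *)
(* Let x be an indeterminate. It is regular and lies in X R[[X]], so x b and
   a x lie in T + X R[[X]] for all series a, b, and
   x b a = 0 <-> b a = 0 <-> b a x = 0. Hence the annihilator of a in R[[X]] is
   determined by its trace on T + X R[[X]], which is also the trace of the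
   annihilator of a x; chains of annihilators thus transfer between both
   rings. *)
Require Import Defs.
From mathcomp Require Import all_boot all_algebra.
From mathcomp Require Import mpoly.

Set Implicit Arguments.
Unset Strict Implicit.
Unset Printing Implicit Defensive.

Import GRing.Theory.

Local Open Scope ring_scope.

Section Monomials.
Variables (n : nat) (R : pzRingType).
Implicit Types (f : mseries n R) (d m : 'X_{1..n}).

Definition msmonom d : mseries n R := MSeries (fun m => (m == d)%:R).

(** Exponents cancel under addition, so in the Cauchy product only the pair [(d, m)] gives a nonzero
    term. *)
Lemma mscoefMonomM d f m : (msmonom d * f) (d + m)%MM = f m.
Proof.
have dN : (mdeg d < (mdeg (d + m)).+1)%N by rewrite mdegD ltnS leq_addr.
have mN : (mdeg m < (mdeg (d + m)).+1)%N by rewrite mdegD ltnS leq_addl.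
rewrite mscoefM (bigD1 (BMultinom dN, BMultinom mN)) //= eqxx mul1r.
rewrite big1 ?addr0 // => -[a b] /= /andP[/eqP dmE ab].
have [ad|_] := eqVneq (a : 'X_{1..n}) d; last by rewrite mul0r.
have mb : m = b by move: dmE; rewrite ad => /addmI.
by case/eqP: ab; congr pair; apply: val_inj.
Qed.

Lemma mscoefMMonom d f m : (f * msmonom d) (m + d)%MM = f m.
Proof.
have dN : (mdeg d < (mdeg (m + d)).+1)%N by rewrite mdegD ltnS leq_addl.
have mN : (mdeg m < (mdeg (m + d)).+1)%N by rewrite mdegD ltnS leq_addr.
rewrite mscoefM (bigD1 (BMultinom mN, BMultinom dN)) //= eqxx mulr1.
rewrite big1 ?addr0 // => -[a b] /= /andP[/eqP mdE ab].
have [bd|_] := eqVneq (b : 'X_{1..n}) d; last by rewrite mulr0.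
have ma : m = a by move: mdE; rewrite bd => /addIm.
by case/eqP: ab; congr pair; apply: val_inj.
Qed.

Lemma msmonom_lreg d : GRing.lreg (msmonom d).
Proof.
by move=> f g fg; apply: mseriesP => m; rewrite -(mscoefMonomM d) fg mscoefMonomM.
Qed.

Lemma msmonom_rreg d : GRing.rreg (msmonom d).
Proof.
by move=> f g fg; apply: mseriesP => m; rewrite -(mscoefMMonom d) fg mscoefMMonom.
Qed.

End Monomials.

Theorem theorem2 (R : pzRingType) (T : subringClosed R) (n : nat)
    (n_gt0 : (0 < n)%N) :
  left_endo_noetherian (cmseries n T) <-> left_endo_noetherian (mseries n R).
Proof.
(* The first indeterminate; [n_gt0] guarantees that there is one. *)
pose x : mseries n R := msmonom R U_(Ordinal n_gt0)%MM.
have x0 : x 0%MM = 0 by rewrite /= eq_sym -mdeg_eq0 mdeg1.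
have xf_in f : x * f \in @const_in n R T by rewrite inE mscoef0M x0 mul0r rpred0.
have fx_in f : f * x \in @const_in n R T by rewrite inE mscoef0M x0 mulr0 rpred0.
have xM_eq0 f : (x * f == 0) = (f == 0) by apply/mulrI_eq0/msmonom_lreg.
have Mx_eq0 f : (f * x == 0) = (f == 0) by apply/mulIr_eq0/msmonom_rreg.
have lannE (a b : cmseries n T) : (b \in lann a) = (cmsval b \in lann (cmsval a)).
  by rewrite !inE -val_eqE.
pose xl f : cmseries n T := CMSeries (xf_in f).
pose xr f : cmseries n T := CMSeries (fx_in f).
have lann_xl f a : (xl f \in lann a) = (f \in lann (cmsval a)).
  by rewrite lannE !inE -mulrA xM_eq0.
have lann_xr (b : cmseries n T) f : (b \in lann (xr f)) = (cmsval b \in lann f).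
  by rewrite lannE !inE mulrA Mx_eq0.
split=> noeth a sub_a.
  have [i b|m stab] := noeth (fun i => xr (a i)).
    by rewrite !lann_xr; apply: sub_a.
  exists m => k /stab eq_km b.
  (* The constant term of [b] may lie outside [T], so stability is tested on [x * b]; then [x]
     cancels on the left. *)
  by have := eq_km (xl b); rewrite !lann_xr !inE -!mulrA !xM_eq0.
have [i b|m stab] := noeth (fun i => cmsval (a i)).
  (* The inclusions extend from the subring to all series [b], since [x * b] lies in the subring and
     annihilates the same elements as [b]. *)
  by rewrite -!lann_xl; apply: sub_a.
(* Equal annihilators in [mseries n R] have equal traces on the subring. *)
by exists m => k /stab eq_km b; rewrite !lannE eq_km.
Qed.
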